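(* Let $G$ be a group. The following properties hold. (1) A short exact sequence of $G$-modules is $\mathfrak F$-split if and only if it is $\mathfrak P$-split. (2) A $G$-module is $\mathfrak F$-projective if and only if it is $\mathfrak P$-projective. (3) $\mathfrak F H^*(G;-)\cong\mathfrak P H^*(G;-)$, i.e. group cohomology relative to $\mathfrak F$ is naturally isomorphic to group cohomology relative to $\mathfrak P$.
   Context: $\mathfrak F$ denotes the class of all finite groups and $\mathfrak P$ denotes the class of finite groups of prime power order (including the trivial group). $G$-modules are $\mathbb Z G$-modules, and $\otimes$ is over $\mathbb Z$ with diagonal $G$-action. For a $G$-set $\Delta$, let $\mathbb Z\Delta$ be the corresponding permutation $G$-module and let $G_\delta$ be the stabilizer of $\delta\in\Delta$. A short exact sequence $A\rightarrowtail B\twoheadrightarrow C$ of $G$-modules is $\Delta$-split if it splits as a sequence of $G_\delta$-modules for each $\delta\in\Delta$; equivalently, if the sequence $A\otimes\mathbb Z\Delta\rightarrowtail B\otimes\mathbb Z\Delta\twoheadrightarrow C\otimes\mathbb Z\Delta$ of $\mathbb ZG$-modules splits. A $G$-module is $\Delta$-projective if it is a direct summand of a $G$-module of the form $N\otimes\mathbb Z\Delta$ with $N$ an arbitrary $G$-module. Let $\mathcal F$ be a class of groups closed under isomorphism and taking subgroups. Consider $G$-sets $\Delta$ such that for all $H\le G$: $\Delta^H\neq\varnothing$ if and only if $H\in\mathcal F$. There are $G$-maps between any two such $G$-sets, so the following notions do not depend on the choice of such $\Delta$: a $G$-module is $\mathcal F$-projective if it is $\Delta$-projective, and a short exact sequence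 of $G$-modules is $\mathcal F$-split if it is $\Delta$-split, for any such $\Delta$. A long exact sequence is $\mathcal F$-split if each of the short exact sequences into which it decomposes is $\mathcal F$-split. An $\mathcal F$-projective resolution of a $G$-module $M$ is an $\mathcal F$-split exact sequence $\cdots\to P_{n+1}\to P_n\to\cdots\to P_0\to M\to 0$ with all $P_i$ $\mathcal F$-projective. Group cohomology relative to $\mathcal F$, denoted $\mathcal F H^*(G;N)$, is the cohomology of the cochain complex $\operatorname{Hom}_G(P_*,N)$, where $P_*$ is an $\mathcal F$-projective resolution of the trivial module $\mathbb Z$. *)

(* Defs.v *)
(* Mathematical Components, with the classical axioms of mathcomp.classical. *)
From HB Require Import structures.
From mathcomp Require Import all_boot all_algebra.
From mathcomp Require Import boolp classical_sets functions cardinality.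
From mathcomp.multinomials Require Import freeg.

Set Implicit Arguments.
Unset Strict Implicit.
Unset Printing Implicit Defensive.

Import GRing.Theory.

Local Open Scope quotient_scope.
Local Open Scope ring_scope.

(** * G-sets and subgroups *)

(* The carrier is a choiceType because {freeg _} wants one; classically every
   type is one. *)
HB.mixin Record isGSet (G : groupType) T := {
  gact : G -> T -> T;
  gact1 : forall x, gact 1%g x = x;
  gactM : forall (g h : G) x, gact (g * h)%g x = gact g (gact h x)
}.

#[short(type="gsetType")]
HB.structure Definition GSet (G : groupType) := {T of Choice T & isGSet G T}.
Arguments gact {G s} g x : simpl never.

Section Subgroup.
Variables (G : groupType) (H : groupClosed G).

Definition subgroup : Type := {x : G | x \in H}.

Lemma subgroup_closed : group_closed H.
Proof.
split; first exact: gpred1.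
by move=> x y xH yH; apply: gpredM => //; apply: gpredVr.
Qed.

HB.instance Definition _ := SubChoice.on subgroup.
HB.instance Definition _ :=
  SubChoice_isSubGroup.Build G _ subgroup subgroup_closed.
End Subgroup.

Section Stabilizer.
Variables (G : groupType) (D : gsetType G) (d : D).

Definition stab : {pred G} := fun g => gact g d == d.

Fact stab1 : 1%g \in stab.
Proof. by rewrite unfold_in gact1. Qed.

Fact stabM : mulg_closed stab.
Proof.
by move=> g h; rewrite !unfold_in gactM => /eqP gd /eqP->; rewrite gd.
Qed.

Fact stabV : invg_closed stab.
Proof.
by move=> g; rewrite !unfold_in => /eqP {1}<-; rewrite -gactM mulVg gact1.
Qed.

HB.instance Definition _ := isMulClosed.Build G stab stabM.
HB.instance Definition _ := isMul1Closed.Build G stab stab1.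
HB.instance Definition _ := isInvClosed.Build G stab stabV.
End Stabilizer.

(** * G-modules *)

HB.mixin Record isGLinear (G : groupType) T of GRing.Zmodule T & isGSet G T := {
  gactD : forall (g : G) (x y : T), gact g (x + y) = gact g x + gact g y
}.

#[short(type="gmodType")]
HB.structure Definition GModule (G : groupType) :=
  {M of GRing.Zmodule M & isGSet G M & isGLinear G M}.

Section GModuleTheory.
Variables (G : groupType) (M : gmodType G).

Fact gact_zmod_morphism (g : G) : zmod_morphism (gact g : M -> M).
Proof.
move=> x y; apply: (addIr (gact g y)).
by rewrite -gactD !subrK.
Qed.

HB.instance Definition _ (g : G) :=
  GRing.isZmodMorphism.Build M M (gact g : M -> M) (gact_zmod_morphism g).
End GModuleTheory.

Definition trivZ (G : groupType) : Type := int.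
Section TrivialModule.
Variable G : groupType.
HB.instance Definition _ := GRing.Zmodule.on (trivZ G).
HB.instance Definition _ := isGSet.Build G (trivZ G)
  (gact := fun _ x => x) (fun _ => erefl) (fun _ _ _ => erefl).
HB.instance Definition _ := isGLinear.Build G (trivZ G) (fun _ _ _ => erefl).
End TrivialModule.

Section DirectSum.
Variables (G : groupType) (M N : gmodType G).
Let act (g : G) (x : M * N) : M * N := (gact g x.1, gact g x.2).
Fact dsum1 x : act 1%g x = x.
Proof. by case: x => x y; rewrite /act !gact1. Qed.
Fact dsumM g h x : act (g * h)%g x = act g (act h x).
Proof. by rewrite /act !gactM. Qed.
Fact dsumD g x y : act g (x + y) = act g x + act g y.
Proof. by rewrite /act /= !raddfD. Qed.

HB.instance Definition _ := isGSet.Build G (M * N)%type dsum1 dsumM.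
HB.instance Definition _ := isGLinear.Build G (M * N)%type dsumD.
End DirectSum.

(** * Hom_G(M, N) *)

Section Hom.
Variables (G : groupType) (M N : gmodType G).

Definition is_ghom (f : M -> N) : Prop :=
  zmod_morphism f /\ forall (g : G) x, f (gact g x) = gact g (f x).

Definition ghom_pred : {pred M -> N} := fun f => `[< is_ghom f >].

Fact ghom_closed : zmod_closed ghom_pred.
Proof.
split=> [|u v]; rewrite !unfold_in.
  by apply/asboolP; split=> [x y|g x]; rewrite ?subr0 ?raddf0.
move=> /asboolP[uB uJ] /asboolP[vB vJ]; apply/asboolP; split=> [x y|g x].
  by rewrite !fctE uB vB !opprD !opprK addrACA.
by rewrite !fctE uJ vJ raddfB.
Qed.

Definition ghom : Type := {f : M -> N | f \in ghom_pred}.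
HB.instance Definition _ := SubChoice.on ghom.
HB.instance Definition _ :=
  GRing.SubChoice_isSubZmodule.Build (M -> N) _ ghom ghom_closed.

Definition ghom_fun (f : ghom) : M -> N := val f.
Coercion ghom_fun : ghom >-> Funclass.

Lemma ghomB (f : ghom) : zmod_morphism f.
Proof. by have /asboolP[] := valP f. Qed.

Lemma ghomJ (f : ghom) g x : f (gact g x) = gact g (f x).
Proof. by have /asboolP[_ fJ] := valP f; exact: fJ. Qed.

HB.instance Definition _ (f : ghom) :=
  GRing.isZmodMorphism.Build M N (ghom_fun f) (ghomB f).

Definition mk_ghom (f : M -> N) (Hf : is_ghom f) : ghom :=
  exist _ f (introT (asboolP _) Hf : f \in ghom_pred).
End Hom.

Section HomComp.
Variables (G : groupType) (L M N : gmodType G).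

Fact comp_is_ghom (g : ghom M N) (f : ghom L M) : is_ghom (g \o f).
Proof. by split=> [x y|h x] /=; rewrite ?raddfB ?ghomJ. Qed.

Definition ghom_comp g f : ghom L N := mk_ghom (comp_is_ghom g f).
End HomComp.

(** * Submodules: kernels and images *)

HB.mixin Record isGStable (G : groupType) (M : gmodType G) (S : {pred M}) := {
  gstable : forall (g : G) x, x \in S -> gact g x \in S
}.
#[short(type="gsubmod")]
HB.structure Definition GSubmodule (G : groupType) (M : gmodType G) :=
  {S of GRing.ZmodClosed M S & isGStable G M S}.

Section Submodule.
Variables (G : groupType) (M : gmodType G) (S : gsubmod M).

Definition submodule : Type := {x : M | x \in S}.
HB.instance Definition _ := SubChoice.on submodule.
HB.instance Definition _ := GRing.SubChoice_isSubZmodule.Build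
  M _ submodule (zmodClosedP S).

Let act (g : G) (x : submodule) : submodule :=
  exist _ (gact g (val x)) (gstable g _ (valP x)).
Fact submod1 x : act 1%g x = x.
Proof. by apply: val_inj; rewrite /= gact1. Qed.
Fact submodM g h x : act (g * h)%g x = act g (act h x).
Proof. by apply: val_inj; rewrite /= gactM. Qed.
HB.instance Definition _ := isGSet.Build G submodule submod1 submodM.
Fact submodD g (x y : submodule) : gact g (x + y) = gact g x + gact g y.
Proof. by apply: val_inj; rewrite /= gactD. Qed.
HB.instance Definition _ := isGLinear.Build G submodule submodD.

Fact submod_incl_is_ghom : is_ghom (val : submodule -> M).
Proof. by split=> // x y; rewrite raddfB. Qed.
Definition submod_incl : ghom submodule M := mk_ghom submod_incl_is_ghom.

Lemma submod_incl_inj : injective submod_incl.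
Proof. exact: val_inj. Qed.
End Submodule.

Section KerIm.
Variables (G : groupType) (M N : gmodType G) (f : ghom M N).

Definition gker : {pred M} := fun x => f x == 0.
Definition gim : {pred N} := fun y => `[< exists x, f x = y >].

Fact gker_closed : zmod_closed gker.
Proof.
split=> [|x y]; rewrite !unfold_in ?raddf0 // raddfB.
by move=> /eqP fx /eqP fy; rewrite /= fx fy subr0.
Qed.
Fact gker_stable (g : G) x : x \in gker -> gact g x \in gker.
Proof. by rewrite !unfold_in ghomJ => /eqP->; rewrite raddf0. Qed.
HB.instance Definition _ := GRing.isZmodClosed.Build M gker gker_closed.
HB.instance Definition _ := isGStable.Build G M gker gker_stable.

Fact gim_closed : zmod_closed gim.
Proof.
split=> [|x y]; rewrite !unfold_in; first by apply/asboolP; exists 0; rewrite raddf0.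
by move=> /asboolP[a <-] /asboolP[b <-]; apply/asboolP; exists (a - b); rewrite raddfB.
Qed.
Fact gim_stable (g : G) x : x \in gim -> gact g x \in gim.
Proof.
rewrite !unfold_in => /asboolP[a <-]; apply/asboolP.
by exists (gact g a); rewrite ghomJ.
Qed.
HB.instance Definition _ := GRing.isZmodClosed.Build N gim gim_closed.
HB.instance Definition _ := isGStable.Build G N gim gim_stable.

Fact mem_gim x : f x \in gim.
Proof. by rewrite unfold_in; apply/asboolP; exists x. Qed.

Definition corestr_fun (x : M) : submodule gim := exist _ (f x) (mem_gim x).

Fact corestr_is_ghom : is_ghom corestr_fun.
Proof.
by split=> [x y|g x]; apply: val_inj; rewrite /= ?raddfB ?ghomJ.
Qed.
Definition corestr : ghom M (submodule gim) := mk_ghom corestr_is_ghom.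
End KerIm.

(** * Quotients and tensor products of abelian groups *)

Local Notation "{ 'quot' I }" := (@Quotient.quot _ I) : type_scope.

Section QuotPi.
Variables (A : zmodType) (I : zmodClosed A).

Definition qpi (x : A) : {quot I} := \pi_({quot I}) x.

Fact qpi_morphism : zmod_morphism qpi.
Proof. by move=> x y; rewrite /qpi !piE. Qed.
HB.instance Definition _ :=
  GRing.isZmodMorphism.Build A {quot I} qpi qpi_morphism.

Lemma qpi_eq x y : (qpi x == qpi y) = (x - y \in I).
Proof. by rewrite Quotient.idealrBE. Qed.

Lemma qpi_repr (x : {quot I}) : qpi (repr x) = x.
Proof. exact: reprK. Qed.
End QuotPi.

Definition quot_lift (A C : zmodType) (I : zmodClosed A) (f : A -> C)
  (x : {quot I}) : C := f (repr x).
Arguments quot_lift {A C} I f x.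

Section QuotLift.
Variables (A C : zmodType) (I : zmodClosed A) (f : {additive A -> C}).
Hypothesis f0 : {in I, forall x, f x = 0}.

Lemma quot_liftE x : quot_lift I f (qpi I x) = f x.
Proof.
apply/eqP; rewrite -subr_eq0 -raddfB; apply/eqP/f0.
by rewrite -qpi_eq qpi_repr.
Qed.

Lemma quot_lift_morphism : zmod_morphism (quot_lift I f).
Proof.
by move=> x y; rewrite -[x]qpi_repr -[y]qpi_repr -raddfB !quot_liftE raddfB.
Qed.
End QuotLift.

(* A (x) B is the quotient of the free abelian group on A * B by the subgroup
   generated by the biadditivity relations. *)
Section Tensor.
Variables A B : zmodType.

Let Fr : zmodType := {freeg (A * B)%type / int}.

Inductive tensor_rel : Fr -> Prop :=
| TensorRelL a a' b : tensor_rel (<<(a + a', b)>> - <<(a, b)>> - <<(a', b)>>)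
| TensorRelR a b b' : tensor_rel (<<(a, b + b')>> - <<(a, b)>> - <<(a, b')>>).

Definition tensor_ker : {pred Fr} := fun x =>
  `[< forall S : {pred Fr},
        zmod_closed S -> (forall r, tensor_rel r -> r \in S) -> x \in S >].

Fact tensor_ker_closed : zmod_closed tensor_ker.
Proof.
split=> [|x y]; rewrite !unfold_in; first by apply/asboolP=> S [].
move=> /asboolP xP /asboolP yP; apply/asboolP=> S Sz SR.
by case: (Sz) => _; apply; [apply: xP | apply: yP].
Qed.
HB.instance Definition _ := GRing.isZmodClosed.Build Fr tensor_ker tensor_ker_closed.

Definition tensor : Type := {quot tensor_ker}.
HB.instance Definition _ := GRing.Zmodule.on tensor.

Definition tens (a : A) (b : B) : tensor := qpi tensor_ker <<(a, b)>>.
End Tensor.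

Lemma freeg_additive_eq (K : choiceType) (C : zmodType)
    (f g : {additive {freeg K / int} -> C}) :
  (forall x, f <<x>> = g <<x>>) -> f =1 g.
Proof.
move=> fg D; rewrite -(freeg_sumE D) !raddf_sum; apply: eq_bigr => x _.
by rewrite -[coeff x D]intz -freegU_mulz !raddfMz fg.
Qed.

Section TensorLift.
Variables (A B C : zmodType) (f : A -> B -> C).
Let f' (x : A * B) : zmodule C := f x.1 x.2.
Let F : {freeg (A * B)%type / int} -> C := fglift f'.

Definition tensor_lift : tensor A B -> C := quot_lift (@tensor_ker A B) F.

Hypothesis fDl : forall a a' b, f (a + a') b = f a b + f a' b.
Hypothesis fDr : forall a b b', f a (b + b') = f a b + f a b'.

Let F_morphism : zmod_morphism F.
Proof. exact: (@lift_is_additive int (A * B)%type (zmodule C) f'). Qed.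
HB.instance Definition _ := GRing.isZmodMorphism.Build _ _ F F_morphism.

Let FU a b : F <<(a, b)>> = f a b.
Proof. by rewrite /F liftU scale1r. Qed.

Let F0 : {in @tensor_ker A B, forall x, F x = 0}.
Proof.
move=> x; rewrite unfold_in => /asboolP/(_ (fun y => F y == 0)) xP.
apply/eqP/xP.
  split=> [|u v]; rewrite !unfold_in ?raddf0 // raddfB.
  by move=> /eqP Fu /eqP Fv; rewrite /= Fu Fv subr0.
move=> r [a a' b|a b b']; rewrite !unfold_in !raddfB /= !FU.
  by rewrite fDl -addrA -opprD subrr.
by rewrite fDr -addrA -opprD subrr.
Qed.

Lemma tensor_lift_morphism : zmod_morphism tensor_lift.
Proof. exact: quot_lift_morphism F0. Qed.

Lemma tensor_liftE a b : tensor_lift (tens a b) = f a b.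
Proof. exact: etrans (quot_liftE F0 _) (FU a b). Qed.
End TensorLift.

Section TensorTheory.
Variables A B : zmodType.

Lemma tensDl (a a' : A) (b : B) : tens (a + a') b = tens a b + tens a' b.
Proof.
apply/eqP; rewrite -subr_eq0 opprD addrA -!raddfB -(raddf0 (qpi _)) qpi_eq subr0.
by rewrite unfold_in; apply/asboolP => S _; apply; left.
Qed.

Lemma tensDr (a : A) (b b' : B) : tens a (b + b') = tens a b + tens a b'.
Proof.
apply/eqP; rewrite -subr_eq0 opprD addrA -!raddfB -(raddf0 (qpi _)) qpi_eq subr0.
by rewrite unfold_in; apply/asboolP => S _; apply; right.
Qed.

Lemma tensor_additive_eq (C : zmodType) (f g : {additive tensor A B -> C}) :
  (forall a b, f (tens a b) = g (tens a b)) -> f =1 g.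
Proof.
move=> fg x; rewrite -[x]qpi_repr.
apply: (freeg_additive_eq (f := f \o qpi _) (g := g \o qpi _)) => -[a b].
exact: fg.
Qed.
End TensorTheory.

Section TensorModule.
Variables (G : groupType) (M N : gmodType G).

Definition tensor_act (g : G) : tensor M N -> tensor M N :=
  tensor_lift (fun a b => tens (gact g a) (gact g b)).

Let actDl (g : G) (a a' : M) (b : N) :
  tens (gact g (a + a')) (gact g b) =
  tens (gact g a) (gact g b) + tens (gact g a') (gact g b).
Proof. by rewrite raddfD tensDl. Qed.

Let actDr (g : G) (a : M) (b b' : N) :
  tens (gact g a) (gact g (b + b')) =
  tens (gact g a) (gact g b) + tens (gact g a) (gact g b').
Proof. by rewrite raddfD tensDr. Qed.

Let act_morphism g : zmod_morphism (tensor_act g).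
Proof. exact: tensor_lift_morphism (actDl g) (actDr g). Qed.

HB.instance Definition _ g :=
  GRing.isZmodMorphism.Build _ _ (tensor_act g) (act_morphism g).

Lemma tensor_actE g a b : tensor_act g (tens a b) = tens (gact g a) (gact g b).
Proof. exact: tensor_liftE (actDl g) (actDr g) a b. Qed.

Fact tensor_act1 x : tensor_act 1%g x = x.
Proof.
apply: (tensor_additive_eq (f := tensor_act 1%g) (g := idfun)) => a b /=.
by rewrite tensor_actE !gact1.
Qed.

Fact tensor_actM g h x : tensor_act (g * h)%g x = tensor_act g (tensor_act h x).
Proof.
apply: (tensor_additive_eq (f := tensor_act (g * h)%g)
                           (g := tensor_act g \o tensor_act h)) => a b /=.
by rewrite !tensor_actE !gactM.
Qed.

Fact tensor_actD g x y : tensor_act g (x + y) = tensor_act g x + tensor_act g y.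
Proof. exact: raddfD. Qed.

HB.instance Definition _ := isGSet.Build G (tensor M N) tensor_act1 tensor_actM.
HB.instance Definition _ := isGLinear.Build G (tensor M N) tensor_actD.
End TensorModule.

(** * Permutation modules *)

Section PermutationModule.
Variables (G : groupType) (D : gsetType G).

Definition permmod : Type := {freeg D / int}.
HB.instance Definition _ := GRing.Zmodule.on permmod.

Definition perm_act (g : G) : permmod -> permmod :=
  fglift (fun d => <<gact g d>>).

Let act_morphism g : zmod_morphism (perm_act g).
Proof. exact: lift_is_additive. Qed.

HB.instance Definition _ g :=
  GRing.isZmodMorphism.Build _ _ (perm_act g) (act_morphism g).

Lemma perm_actE g d : perm_act g <<d>> = <<gact g d>>.
Proof. by rewrite /perm_act liftU scale1r. Qed.

Fact perm_act1 x : perm_act 1%g x = x.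
Proof.
apply: (freeg_additive_eq (f := perm_act 1%g) (g := idfun)) => d /=.
by rewrite perm_actE gact1.
Qed.

Fact perm_actM g h x : perm_act (g * h)%g x = perm_act g (perm_act h x).
Proof.
apply: (freeg_additive_eq (f := perm_act (g * h)%g)
                          (g := perm_act g \o perm_act h)) => d /=.
by rewrite !perm_actE gactM.
Qed.

Fact perm_actD g x y : perm_act g (x + y) = perm_act g x + perm_act g y.
Proof. exact: raddfD. Qed.

HB.instance Definition _ := isGSet.Build G permmod perm_act1 perm_actM.
HB.instance Definition _ := isGLinear.Build G permmod perm_actD.
End PermutationModule.

(** * Relative splitting and relative projectivity *)

Record ses (G : groupType) := SES {
  ses_sub : gmodType G;
  ses_mid : gmodType G;
  ses_quo : gmodType G;
  ses_inj : ghom ses_sub ses_mid;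
  ses_proj : ghom ses_mid ses_quo;
  ses_injective : injective ses_inj;
  ses_surjective : forall c, exists b, ses_proj b = c;
  ses_exact : forall b, ses_proj b = 0 <-> exists a, ses_inj a = b
}.

Section Relative.
Variable G : groupType.
Implicit Types (E : ses G) (M : gmodType G) (D : gsetType G).

(* s is a section of the epimorphism and a homomorphism of H-modules. *)
Definition splits_over (H : groupClosed G) E :=
  exists s : {additive ses_quo E -> ses_mid E},
    (forall h c, h \in H -> s (gact h c) = gact h (s c)) /\
    (forall c, ses_proj E (s c) = c).

Definition D_split D E := forall d : D, splits_over (stab d) E.

Definition direct_summand M (X : gmodType G) :=
  exists (K : gmodType G) (phi : ghom X (M * K)%type), bijective phi.

Definition D_projective D M :=
  exists N : gmodType G, direct_summand M (tensor N (permmod D)).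

Definition classifying (F : groupType -> Prop) D :=
  forall H : groupClosed G,
    (exists d : D, forall h, h \in H -> gact h d = d) <-> F (subgroup H).

(* For a class F closed under isomorphism and subgroups, such a D exists and
   neither notion depends on which one is taken. *)
Definition F_split F E :=
  exists2 D : gsetType G, classifying F D & D_split D E.

Definition F_projective F M :=
  exists2 D : gsetType G, classifying F D & D_projective D M.
End Relative.

Section KerImSES.
Variables (G : groupType) (M N : gmodType G) (f : ghom M N).

Fact ker_im_surjective c : exists b, corestr f b = c.
Proof.
case: c => c cP; have /asboolP[b bc] := cP.
by exists b; apply: val_inj.
Qed.

Fact ker_im_exact b : corestr f b = 0 <-> exists a, submod_incl (gker f) a = b.
Proof.
split=> [/(congr1 val)/= fb|[a <-]].
  have bK : b \in gker f by apply/eqP.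
  by exists (exist _ b bK).
by apply: val_inj; have /eqP := valP a.
Qed.

(* Exact sequences decompose into the sequences ker f >-> M ->> im f, for f
   running over their maps. *)
Definition ker_im_ses : ses G :=
  SES (@submod_incl_inj _ _ (gker f)) ker_im_surjective ker_im_exact.
End KerImSES.

(** * Relative cohomology *)

Record resolution (G : groupType) (F : groupType -> Prop) (M : gmodType G) :=
  Resolution {
    res_obj :> nat -> gmodType G;
    res_d : forall n, ghom (res_obj n.+1) (res_obj n);
    res_aug : ghom (res_obj 0%N) M;
    res_surj : forall m, exists x, res_aug x = m;
    res_exact0 : forall x, res_aug x = 0 <-> exists y, res_d 0%N y = x;
    res_exact : forall n x, res_d n x = 0 <-> exists y, res_d n.+1 y = x;
    res_split0 : F_split F (ker_im_ses res_aug);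
    res_split : forall n, F_split F (ker_im_ses (res_d n));
    res_proj : forall n, F_projective F (res_obj n)
  }.

Record cochain := Cochain {
  cc_obj :> nat -> zmodType;
  cc_d : forall n, {additive cc_obj n -> cc_obj n.+1};
  cc_dd : forall n x, cc_d n.+1 (cc_d n x) = 0
}.

Section Cohomology.
Variables (C : cochain) (n : nat).

Definition cocycle_pred : {pred C n} := fun x => cc_d C n x == 0.
Fact cocycle_closed : zmod_closed cocycle_pred.
Proof.
split=> [|x y]; rewrite !unfold_in ?raddf0 // raddfB.
by move=> /eqP dx /eqP dy; rewrite /= dx dy subr0.
Qed.
HB.instance Definition _ := GRing.isZmodClosed.Build _ cocycle_pred cocycle_closed.

Definition cocycle : Type := {x : C n | x \in cocycle_pred}.
HB.instance Definition _ := SubChoice.on cocycle.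
HB.instance Definition _ :=
  GRing.SubChoice_isSubZmodule.Build _ _ cocycle cocycle_closed.
End Cohomology.

Section Coboundary.
Variable C : cochain.

Definition is_coboundary n : C n -> Prop :=
  match n with
  | 0 => fun x => x = 0
  | m.+1 => fun x => exists y, cc_d C m y = x
  end.

Lemma is_coboundary0 n : is_coboundary (0 : C n).
Proof. by case: n => //= m; exists 0; rewrite raddf0. Qed.

Lemma is_coboundaryB n (x y : C n) :
  is_coboundary x -> is_coboundary y -> is_coboundary (x - y).
Proof.
case: n x y => [|m] x y /=; first by move=> -> ->; rewrite subr0.
by move=> [a <-] [b <-]; exists (a - b); rewrite raddfB.
Qed.

Variable n : nat.

Definition coboundary : {pred cocycle C n} := fun x => `[< is_coboundary (val x) >].

Fact coboundary_closed : zmod_closed coboundary.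
Proof.
split=> [|x y]; rewrite !unfold_in.
  by apply/asboolP; exact: is_coboundary0.
by move=> /asboolP xB /asboolP yB; apply/asboolP; exact: is_coboundaryB.
Qed.
HB.instance Definition _ := GRing.isZmodClosed.Build _ coboundary coboundary_closed.

Definition cohomology : zmodType := {quot coboundary}.
End Coboundary.

Record cochain_map (C D : cochain) := CochainMap {
  cm_fun :> forall n, {additive C n -> D n};
  cm_comm : forall n x, cm_fun n.+1 (cc_d C n x) = cc_d D n (cm_fun n x)
}.

Section CohomologyMap.
Variables (C D : cochain) (f : cochain_map C D) (n : nat).

Fact cocycle_map_proof (x : cocycle C n) : f n (val x) \in @cocycle_pred D n.
Proof.
have /eqP xZ := valP x.
by rewrite unfold_in -cm_comm xZ raddf0.
Qed.

Definition cocycle_map (x : cocycle C n) : cocycle D n :=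
  exist _ (f n (val x)) (cocycle_map_proof x).

Fact cocycle_map_morphism : zmod_morphism cocycle_map.
Proof. by move=> x y; apply: val_inj; rewrite /= !raddfB. Qed.
HB.instance Definition _ :=
  GRing.isZmodMorphism.Build _ _ cocycle_map cocycle_map_morphism.

Lemma is_coboundary_map (x : C n) : is_coboundary x -> is_coboundary (f n x).
Proof.
case: n x => [|m] x /=; first by move->; rewrite raddf0.
by move=> [y <-]; exists (f m y); rewrite cm_comm.
Qed.

Definition cohomology_map : cohomology C n -> cohomology D n :=
  quot_lift (@coboundary C n) (qpi (@coboundary D n) \o cocycle_map).

Let map0 : {in @coboundary C n,
  forall x, (qpi (@coboundary D n) \o cocycle_map) x = 0}.
Proof.
move=> x xB; apply/eqP; rewrite -(raddf0 (qpi _)) qpi_eq subr0.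
move: xB; rewrite !unfold_in => /asboolP xB; apply/asboolP.
exact: is_coboundary_map xB.
Qed.

Lemma cohomology_mapE x :
  cohomology_map (qpi _ x) = qpi _ (cocycle_map x).
Proof. exact: quot_liftE map0 x. Qed.

Lemma cohomology_map_morphism : zmod_morphism cohomology_map.
Proof. exact: quot_lift_morphism map0. Qed.
HB.instance Definition _ :=
  GRing.isZmodMorphism.Build _ _ cohomology_map cohomology_map_morphism.
End CohomologyMap.

Section RelativeCohomology.
Variables (G : groupType) (F : groupType -> Prop) (M : gmodType G).
Variable P : resolution F M.

Definition hom_d (N : gmodType G) n (f : ghom (P n) N) : ghom (P n.+1) N :=
  ghom_comp f (res_d P n).

Fact hom_d_morphism N n : zmod_morphism (@hom_d N n).
Proof. by move=> f g; apply: val_inj. Qed.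
HB.instance Definition _ N n :=
  GRing.isZmodMorphism.Build _ _ (@hom_d N n) (@hom_d_morphism N n).

Fact hom_dd N n (f : ghom (P n) N) : hom_d (hom_d f) = 0.
Proof.
apply: val_inj; apply/funext => x /=.
have ddx : res_d P n (res_d P n.+1 x) = 0 by apply/res_exact; exists x.
exact: etrans (congr1 f ddx) (raddf0 f).
Qed.

Definition hom_cochain (N : gmodType G) : cochain :=
  @Cochain (fun n => ghom (P n) N) (fun n => @hom_d N n) (@hom_dd N).

Definition rel_cohomology (n : nat) (N : gmodType G) : zmodType :=
  cohomology (hom_cochain N) n.

Section Functoriality.
Variables (N N' : gmodType G) (u : ghom N N').

Definition hom_map n (f : ghom (P n) N) : ghom (P n) N' := ghom_comp u f.

Fact hom_map_morphism n : zmod_morphism (@hom_map n).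
Proof. by move=> f g; apply: val_inj; apply/funext => x /=; rewrite raddfB. Qed.
HB.instance Definition _ n :=
  GRing.isZmodMorphism.Build _ _ (@hom_map n) (@hom_map_morphism n).

Fact hom_map_comm n (f : ghom (P n) N) : hom_map (hom_d f) = hom_d (hom_map f).
Proof. exact: val_inj. Qed.

Definition hom_cochain_map : cochain_map (hom_cochain N) (hom_cochain N') :=
  @CochainMap (hom_cochain N) (hom_cochain N') (fun n => @hom_map n) hom_map_comm.

Definition rel_cohomology_map (n : nat) :
    rel_cohomology n N -> rel_cohomology n N' :=
  @cohomology_map _ _ hom_cochain_map n.
End Functoriality.
End RelativeCohomology.

Arguments rel_cohomology_map {G F M} P {N N'} u {n} x.

(** * The two classes of finite groups *)

Definition finite_groups (K : groupType) : Prop := finite_set [set: K].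

Definition prime_power_groups (K : groupType) : Prop :=
  exists p k : nat, prime p /\ ([set: K] #= `I_(p ^ k))%card.

(* Main.v *)
Require Import Defs.
From HB Require Import structures.
From mathcomp Require Import all_boot all_algebra fingroup pgroup sylow.
From mathcomp Require Import boolp classical_sets functions cardinality.
From mathcomp.multinomials Require Import freeg.

Set Implicit Arguments.
Unset Strict Implicit.
Unset Printing Implicit Defensive.

Import GRing.Theory.

Local Open Scope ring_scope.

(** Only the first of the three claims carries arithmetic. A sequence is split
    relative to a class F, closed under passage to groups that embed into a
    member, exactly when it splits over every subgroup in F (F_splitP); so
    finite-split trivially implies prime-power-split. For the converse, fix a
    finite subgroup H. The integers n such that n times the identity of the
    quotient module lifts to an H-map into the middle module are closed under
    greatest common divisors. The conjugates of a section over a Sylow p-subgroup S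
    by the cosets in H / S add up to a map showing that the index of S is such
    an integer (transfer). Since that index is prime to p, and p is an arbitrary prime, 1 is such an
    integer, and the sequence splits over H (splits_over_Sylow).

    The other two claims follow formally. A D-projective module lifts against
    every D-split sequence: a tensor product with the permutation module of D
    is generated freely, in the second factor, by D, so one only has to choose
    sections of the sequence over the stabilizers compatibly along each orbit
    (D_split_equivariant, D_projective_lift). Conversely, if M lifts against
    every D-split sequence, the augmentation of M tensored with the permutation
    module, which is D-split, has a G-equivariant section, and M is a direct
    summand. Relative projectivity thus depends only on which sequences are
    relatively split.

    Consequently the terms of a resolution relative to one class lift against
    the maps of a resolution relative to the other one. The usual comparison
    argument then yields chain maps in both directions, with composites
    homotopic to the identity, and precomposition with them gives mutually
    inverse maps in cohomology. Precomposition commutes with postcomposition,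
    whence naturality in the coefficients (rel_cohomology_iso). *)

(** * G-sets classifying a class of groups *)

Lemma in_stab (G : groupType) (D : gsetType G) (d : D) g :
  (g \in stab d) = (gact g d == d).
Proof. by []. Qed.

(** Closure under isomorphism and under subgroups, in a single condition. *)
Definition embedding_closed (F : groupType -> Prop) :=
  forall (K L : groupType) (f : K -> L),
    injective f -> {morph f : x y / (x * y)%g} -> F L -> F K.

Lemma embedding_closed_subgroup (F : groupType -> Prop) (G : groupType)
    (H K : groupClosed G) (f : G -> G) :
  embedding_closed F -> {morph f : x y / (x * y)%g} -> injective f ->
  (forall x, x \in H -> f x \in K) -> F (subgroup K) -> F (subgroup H).
Proof.
move=> F_emb fM f_inj fHK.
pose f' (x : subgroup H) : subgroup K :=
  exist (fun y => y \in K) _ (fHK _ (valP x)).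
apply: (F_emb _ _ f') => [x y /(congr1 val) /f_inj/val_inj //|x y].
by apply: val_inj; rewrite /= fM.
Qed.

(** The classifying G-set consists of the subsets A of G whose stabilizer under
    left translation belongs to F. Working with all subsets, instead of cosets of
    members of F, makes the fixed point condition immediate: a subgroup H fixes A
    when it is contained in the stabilizer of A, and H as a subset of G has
    stabilizer H. *)
Section Translates.
Variable G : groupType.

(** A copy of the power set, so that the translation action is attached to it
    alone. *)
Definition subset_of : Type := set G.
HB.instance Definition _ := Choice.on subset_of.

Let translate (g : G) (A : subset_of) : subset_of := fun x => A (g^-1 * x)%g.
Fact translate1 A : translate 1 A = A.
Proof. by apply/funext => x; rewrite /translate invg1 mul1g. Qed.
Fact translateM g h A : translate (g * h) A = translate g (translate h A).
Proof. by apply/funext => x; rewrite /translate invgM mulgA. Qed.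
HB.instance Definition _ := isGSet.Build G subset_of translate1 translateM.

Variable F : groupType -> Prop.
Hypothesis F_emb : embedding_closed F.

Definition F_stable : {pred subset_of} := fun A => `[< F (subgroup (stab A)) >].
Definition F_subset : Type := {A : subset_of | A \in F_stable}.
HB.instance Definition _ := SubChoice.on F_subset.

(** Translation by g conjugates stabilizers. *)
Lemma F_stable_translate g A : A \in F_stable -> gact g A \in F_stable.
Proof.
rewrite !unfold_in => /asboolP FA; apply/asboolP.
apply: (embedding_closed_subgroup (f := conjg^~ g) F_emb) FA.
- by move=> x y; rewrite conjMg.
- exact: conjg_inj.
move=> x; rewrite !in_stab /conjg !gactM => /eqP->.
by rewrite -gactM mulVg gact1.
Qed.

Let act g (A : F_subset) : F_subset :=
  exist _ (gact g (val A)) (F_stable_translate g (valP A)).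
Fact F_subset1 A : act 1%g A = A.
Proof. by apply: val_inj; rewrite /= gact1. Qed.
Fact F_subsetM g h A : act (g * h)%g A = act g (act h A).
Proof. by apply: val_inj; rewrite /= gactM. Qed.

Lemma exists_classifying : exists D : gsetType G, classifying F D.
Proof.
pose D : gsetType G :=
  HB.pack F_subset (isGSet.Build G F_subset F_subset1 F_subsetM).
exists D => H; split=> [[A fixA]|FH].
  have /asboolP FA := valP A.
  apply: (embedding_closed_subgroup (f := idfun) F_emb) FA => //= x xH.
  by apply/eqP; exact: (congr1 (fun B : F_subset => val B) (fixA _ xH)).
pose A : subset_of := fun x => x \in H.
have stabA g : (g \in stab A) = (g \in H).
  apply/eqP/idP => [/(congr1 (@^~ g))|gH].
    by rewrite /A /gact /= /translate mulVg => <-; exact: gpred1.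
  apply/funext => x; rewrite /A /gact /= /translate.
  by apply/propext; rewrite gpredMl ?gpredVr.
have AP : A \in F_stable.
  apply/asboolP.
  apply: (embedding_closed_subgroup (f := idfun) F_emb) FH => //= x.
  by rewrite stabA.
exists (exist _ A AP : D) => h; rewrite -stabA => /eqP hA.
exact: val_inj.
Qed.
End Translates.

(** * Finite groups and groups of prime power order *)

Section GroupMorphism.
Variables (K L : groupType) (a : K -> L).
Hypothesis aM : {morph a : x y / (x * y)%g}.

Lemma morph_one : a 1%g = 1%g.
Proof. by apply: (mulgI (a 1%g)); rewrite -aM !mulg1. Qed.

Lemma morph_inv x : a x^-1%g = (a x)^-1%g.
Proof. by apply: (mulgI (a x)); rewrite -aM !mulgV morph_one. Qed.
End GroupMorphism.

Lemma card_bijective (T : finType) (K : Type) (f : T -> K) :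
  bijective f -> ([set: K] #= `I_#|T|)%card.
Proof.
case=> g fK gK; apply/card_set_bijP;
  exists (fun x => enum_rank (g x) : nat); split.
- by move=> x _; exact: ltn_ord.
- by move=> x y _ _ /val_inj/enum_rank_inj/(congr1 f); rewrite !gK.
- move=> i /= i_lt; exists (f (enum_val (Ordinal i_lt))) => //.
  by rewrite fK enum_valK.
Qed.

(** Gives access to Sylow theory for a group that is merely known to be finite. *)
Lemma finGroup_of (K : groupType) : finite_groups K ->
  exists (T : finGroupType) (f : T -> K),
    bijective f /\ {morph f : x y / (x * y)%g}.
Proof.
move=> /finite_seqP[s Ks].
have s_full x : x \in s by have : [set: K]%classic x by []; rewrite Ks.
have pickleK : pcancel (index^~ s) (onth s).
  by move=> x; rewrite onthE (nth_map x) ?index_mem ?nth_index.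
have enumP (C : countType) (e : seq C) : (forall x, x \in e) ->
    Finite.axiom (undup e).
  by move=> e_full x; rewrite count_uniq_mem ?undup_uniq // mem_undup e_full.
pose KC := Choice_isCountable.Build K pickleK.
pose C : countType := HB.pack K KC.
pose T : finGroupType := HB.pack K KC
  (isFinite.Build K (enumP C s s_full)).
by exists T, (idfun : T -> K); split=> //; exists idfun.
Qed.

Lemma finite_groups_closed : embedding_closed finite_groups.
Proof.
move=> K L f f_inj _ finL.
apply: sub_finite_set (finite_preimage (f := f) _ finL) => //.
by move=> x y _ _; apply: f_inj.
Qed.

Lemma prime_power_finite (K : groupType) :
  prime_power_groups K -> finite_groups K.
Proof. by move=> [p [k [_ Kpk]]]; exists (p ^ k)%N. Qed.

Lemma prime_power_groupsE (T : finGroupType) (K : groupType) (f : T -> K) :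
  bijective f ->
  prime_power_groups K <-> exists2 p, prime p & exists k, #|T| = (p ^ k)%N.
Proof.
move=> /card_bijective KT; split=> [[p [k [p_pr Kpk]]]|[p p_pr [k Tpk]]].
  exists p => //; exists k; apply/card_eq_II.
  exact: card_eq_trans (card_esym KT) Kpk.
by exists p, k; rewrite -Tpk.
Qed.

(** Lagrange: the order of the image of K divides a power of p. *)
Lemma prime_power_closed : embedding_closed prime_power_groups.
Proof.
move=> K L f f_inj fM ppL.
have finL := prime_power_finite ppL.
have [T [t [t_bij tM]]] := finGroup_of finL.
have [S [s [s_bij sM]]] := finGroup_of (finite_groups_closed f_inj fM finL).
have [p p_pr [k Tpk]] := (prime_power_groupsE t_bij).1 ppL.
apply/(prime_power_groupsE s_bij); exists p => //.
have [t' tK t'K] := t_bij.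
pose g x := t' (f (s x)).
have gM : {morph g : x y / (x * y)%g}.
  by move=> x y; apply: (bij_inj t_bij); rewrite tM !t'K sM fM.
have g_inj : injective g.
  by move=> x y /(can_inj t'K)/f_inj/(bij_inj s_bij).
have gG : group_set [set g x | x in [set: S]].
  apply/group_setP; split.
    by apply/imsetP; exists 1%g; rewrite ?(morph_one gM).
  move=> _ _ /imsetP[x _ ->] /imsetP[y _ ->].
  by rewrite -gM imset_f.
have /cardSg : Group gG \subset [set: T]%g by apply: finset.subsetT.
rewrite /= card_imset // !cardsT Tpk.
by move=> /(dvdn_pfactor _ _ p_pr)[j _ ->]; exists j.
Qed.

(** * Transfer from Sylow subgroups *)

Section Transfer.
Variables (G : groupType) (E : ses G) (T : finGroupType) (a : T -> G).
Hypothesis aM : {morph a : x y / (x * y)%g}.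

(** T acts on the modules through a. The number n counts how far s is from being
    a section: n = 1 gives a splitting over the subset A. *)
Definition section_multiple (A : {set T}) (n : nat) :=
  exists s : ses_quo E -> ses_mid E,
    [/\ zmod_morphism s,
        forall x c, x \in A -> s (gact (a x) c) = gact (a x) (s c)
      & forall c, ses_proj E (s c) = c *+ n].

(** Conjugating a P-equivariant section by x only depends on the coset of x
    modulo P; the sum of these conjugates over all cosets is equivariant because
    left multiplication permutes the cosets. *)
Lemma transfer (P : {group T}) :
  section_multiple P 1 -> section_multiple [set: T]%G #|[set: T]%G : P|%g.
Proof.
move=> [s [sB sP projs]].
pose conj x c := gact (a x) (s (gact (a x)^-1%g c)).
have conjR x y c : y \in P -> conj (x * y)%g c = conj x c.
  move=> yP; rewrite /conj aM invgM !gactM -(morph_inv aM y) sP ?groupV //.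
  by rewrite -(gactM (a y)) -aM mulgV (morph_one aM) gact1.
have conj_repr x c : conj (repr (x *: P)%g) c = conj x c.
  by have /lcosetP[y yP ->] := mem_repr x (lcoset_refl P x); rewrite conjR.
exists (fun c => \sum_(X in lcosets P [set: T]%G) conj (repr X) c); split.
- move=> c c'; rewrite -sumrB; apply: eq_bigr => X _.
  by rewrite /conj raddfB sB raddfB.
- move=> x c _; rewrite raddf_sum.
  rewrite (reindex_inj (@lcoset_inj _ x)).
  apply: eq_big => [X|X XP].
    apply/lcosetsP/lcosetsP => -[y _].
      move/(congr1 (fun Z => (x^-1 *: Z)%g)); rewrite lcosetK -lcosetM => ->.
      by exists (x^-1 * y)%g.
    by move->; exists (x * y)%g; rewrite ?inE ?lcosetM.
  have [y _ /(congr1 (fun Z => (x^-1 *: Z)%g))] := lcosetsP XP.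
  rewrite lcosetK -lcosetM => ->; move: (x^-1 * y)%g => z.
  rewrite -lcosetM !conj_repr /conj aM gactM; congr (gact _ (gact _ (s _))).
  by rewrite -gactM invgM -mulgA mulVg mulg1.
move=> c; rewrite raddf_sum -card_lcosets -sumr_const.
apply: eq_bigr => X _.
by rewrite /conj /= ghomJ projs mulr1n -gactM mulgV gact1.
Qed.

(** A Bezout combination of the two maps. *)
Lemma section_multiple_gcd (A : {set T}) m n : (0 < m)%N ->
  section_multiple A m -> section_multiple A n ->
  section_multiple A (gcdn m n).
Proof.
move=> m_gt0 [s [sB sA sm]] [t [tB tA tn]].
case: (egcdnP n m_gt0) => u v uv _.
exists (fun c => s c *+ u - t c *+ v); split=> [c c'|x c xA|c].
- rewrite sB tB !mulrnBl !opprB addrACA [RHS]addrACA; congr (_ + _).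
  by rewrite addrC.
- by rewrite sA // tA // raddfB /= !raddfMn.
rewrite raddfB !(raddfMn (ses_proj E)) /= sm tn -!mulrnA (mulnC m) uv mulrnDr.
by rewrite (mulnC n) addrAC subrr add0r.
Qed.

(** The least positive n that is realised divides every other one. If a prime p
    divided it, p would divide the index of a Sylow p-subgroup; so n = 1. *)
Lemma section_of_Sylow_sections :
  (forall p (P : {group T}), prime p -> p.-Sylow([set: T]%G)%g P ->
     section_multiple P 1) ->
  section_multiple [set: T]%G 1.
Proof.
move=> split_Sylow.
suff [n [n_gt0 [n_split n_min]]]: exists n, (0 < n)%N /\
    section_multiple [set: T]%G n /\
    forall m, (0 < m)%N -> section_multiple [set: T]%G m -> (n <= m)%N.
  have [n_gt1|] := ltnP 1 n; last by case: n n_gt0 n_split {n_min} => [|[]].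
  have p_pr := pdiv_prime n_gt1; set p := pdiv n in p_pr.
  have [P sylP] := Sylow_exists p [set: T]%G.
  have gcd_gt0 : (0 < gcdn n #|[set: T]%G : P|%g)%N by rewrite gcdn_gt0 n_gt0.
  have := n_min _ gcd_gt0 (section_multiple_gcd n_gt0 n_split
    (transfer (split_Sylow _ _ p_pr sylP))).
  move=> n_le; have n_dvd : (n %| #|[set: T]%G : P|%g)%N.
    have /dvdn_leq := dvdn_gcdl n #|[set: T]%G : P|%g => /(_ n_gt0) le_n.
    have /eqP gcd_n : gcdn n #|[set: T]%G : P|%g == n by rewrite eqn_leq le_n.
    by rewrite -gcd_n dvdn_gcdr.
  have := dvdn_trans (pdiv_dvd n) n_dvd.
  have /and3P[_ _ ] := sylP.
  by rewrite p'natE // => /negPf->.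
(* Any prime will do here: the index only witnesses that some n is realised. *)
have [P sylP] := Sylow_exists 2 [set: T]%G.
have P_split := transfer (split_Sylow 2%N P isT sylP).
pose Q n := (0 < n)%N && `[< section_multiple [set: T]%G n >].
have exQ : exists n, Q n.
  by exists #|[set: T]%G : P|%g; rewrite /Q indexg_gt0; apply/asboolP.
have [n /andP[n_gt0 /asboolP n_split] n_min] := ex_minnP exQ.
exists n; split=> //; split=> // m m_gt0 m_split.
by apply: n_min; rewrite /Q m_gt0; apply/asboolP.
Qed.
End Transfer.

(** Sylow subgroups live in the abstract finite group T; splitting is a notion
    for subgroups of G, so they are pushed forward along a. *)
Section GroupImage.
Variables (G : groupType) (T : finGroupType) (a : T -> G) (P : {group T}).
Hypothesis aM : {morph a : x y / (x * y)%g}.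

Definition group_image : {pred G} :=
  fun g => `[< exists2 x, x \in P & a x = g >].

Lemma group_imageP g :
  reflect (exists2 x, x \in P & a x = g) (g \in group_image).
Proof. exact: asboolP. Qed.

Fact group_image1 : 1%g \in group_image.
Proof. by apply/group_imageP; exists 1%g; rewrite ?(morph_one aM). Qed.

Fact group_imageM : mulg_closed group_image.
Proof.
move=> _ _ /group_imageP[x xP <-] /group_imageP[y yP <-].
by apply/group_imageP; exists (x * y)%g; rewrite ?groupM.
Qed.

Fact group_imageV : invg_closed group_image.
Proof.
move=> _ /group_imageP[x xP <-]; apply/group_imageP.
by exists x^-1%g; rewrite ?groupV ?(morph_inv aM).
Qed.

Definition image_group : groupClosed G :=
  HB.pack group_image (isMulClosed.Build G group_image group_imageM)
    (isMul1Closed.Build G group_image group_image1)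
    (isInvClosed.Build G group_image group_imageV).

Lemma prime_power_image_group p : injective a -> prime p -> (p.-group P)%g ->
  prime_power_groups (subgroup image_group).
Proof.
move=> a_inj p_pr /p_natP[k Ppk].
have preimP (y : subgroup image_group) : {x | x \in P & a x = val y}.
  by apply/cid2/group_imageP; exact: valP.
pose preim y : [subg P] := Subg (s2valP (preimP y)).
have preimK y : a (sgval (preim y)) = val y by exact: s2valP' (preimP y).
apply: (prime_power_closed (f := preim : _ -> [subg P] : groupType)).
- by move=> x y xy; apply: val_inj; rewrite -!preimK xy.
- by move=> x y; apply/subg_inj/a_inj; rewrite preimK /= aM !preimK.
apply/(prime_power_groupsE (f := idfun : [subg P] -> _)); first by exists idfun.
by exists p => //; exists k; rewrite card_sub -Ppk; apply: eq_card.
Qed.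
End GroupImage.

Lemma splits_over_Sylow (G : groupType) (H : groupClosed G) (E : ses G) :
  finite_groups (subgroup H) ->
  (forall S : groupClosed G, {subset S <= H} ->
     prime_power_groups (subgroup S) -> splits_over S E) ->
  splits_over H E.
Proof.
move=> /finGroup_of[T [f [f_bij fM]]] split_p.
pose a x := val (f x).
have aM : {morph a : x y / (x * y)%g} by move=> x y; rewrite /a fM.
have a_inj : injective a by move=> x y /val_inj/(bij_inj f_bij).
have [|s [sB sT projs]] := section_of_Sylow_sections (E := E) aM.
  move=> p P p_pr /and3P[_ P_p _].
  have [||s [sS projs]] := split_p (image_group P aM).
  - by move=> _ /group_imageP[x _ <-]; exact: valP.
  - exact: prime_power_image_group P_p.
  exists s; split=> [|x c xP|c]; [exact: raddfB| |by rewrite projs].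
  by apply: sS; apply/group_imageP; exists x.
pose s' : {additive ses_quo E -> ses_mid E} :=
  HB.pack s (GRing.isZmodMorphism.Build _ _ s sB).
exists s'; split=> [h c hH|c]; last by rewrite /= projs.
have [f' _ fK] := f_bij.
have := sT (f' (exist (fun g => g \in H) h hH)) c (finset.in_setT _).
by rewrite /a fK.
Qed.

(** * Finite-split and prime-power-split sequences *)

Section SplitTransfer.
Variable G : groupType.
Implicit Types (E : ses G) (D : gsetType G).

Lemma splits_over_sub (H K : groupClosed G) E :
  {subset H <= K} -> splits_over K E -> splits_over H E.
Proof.
by move=> HK [s [sK projs]]; exists s; split=> // h c /HK; apply: sK.
Qed.

Lemma classifying_stab F D (d : D) : classifying F D -> F (subgroup (stab d)).
Proof. by move=> clD; apply/clD; exists d => h /eqP. Qed.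

(** The stabilizers of a classifying G-set belong to F, and every subgroup in F
    lies in one of them. This removes the G-set from the definition. *)
Lemma F_splitP F D E : classifying F D ->
  F_split F E <->
  forall H : groupClosed G, F (subgroup H) -> splits_over H E.
Proof.
move=> clD; split=> [[D' clD' splitE] H /clD'[d dH]|splitE].
  by apply: splits_over_sub (splitE d) => h /dH/eqP.
by exists D => // d; apply: splitE; apply: classifying_stab.
Qed.

Lemma finite_split_iff E :
  F_split finite_groups E <-> F_split prime_power_groups E.
Proof.
have [D clD] := exists_classifying G finite_groups_closed.
have [D' clD'] := exists_classifying G prime_power_closed.
split=> [/(F_splitP _ clD) splitE|/(F_splitP _ clD') splitE].
  by apply/(F_splitP _ clD') => H /prime_power_finite; apply: splitE.
apply/(F_splitP _ clD) => H finH; apply: splits_over_Sylow finH _ => S _.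
exact: splitE.
Qed.
End SplitTransfer.

(** * Relative projectivity as a lifting property *)

(** Additive maps out of N tensored with the permutation module of D are the
    same as families, indexed by D, of additive maps out of N. *)
Section PermutationTensor.
Variables (G : groupType) (D : gsetType G) (N : zmodType).

Lemma tensr_is_additive (M : zmodType) (n : N) :
  zmod_morphism (tens n : M -> tensor N M).
Proof.
move=> x y; apply: (addIr (tens n y)).
by rewrite -tensDr !subrK.
Qed.

Lemma tensl_is_additive (M : zmodType) (x : M) :
  zmod_morphism ((@tens N M)^~ x).
Proof.
move=> n n'; apply: (addIr (tens n' x)).
by rewrite -tensDl !subrK.
Qed.

Definition tens_basis (d : D) : {additive N -> tensor N (permmod D)} :=
  HB.pack ((@tens N (permmod D))^~ <<d>>)
    (GRing.isZmodMorphism.Build _ _ _ (tensl_is_additive (<<d>> : permmod D))).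

Lemma tensor_perm_eq (C : zmodType)
    (f g : {additive tensor N (permmod D) -> C}) :
  (forall n d, f (tens n <<d>>) = g (tens n <<d>>)) -> f =1 g.
Proof.
move=> fg; apply: tensor_additive_eq => n.
pose tn : {additive permmod D -> _} :=
  HB.pack (tens n) (GRing.isZmodMorphism.Build _ _ _ (tensr_is_additive n)).
by apply: (freeg_additive_eq (f := f \o tn) (g := g \o tn)) => d; apply: fg.
Qed.

Variables (C : zmodType) (k : D -> {additive N -> C}).

Let lift n : permmod D -> C := fglift (fun d => k d n : zmodule C).

Let lift_morphism n : zmod_morphism (lift n).
Proof. exact: (@lift_is_additive int D (zmodule C)). Qed.

HB.instance Definition _ n :=
  GRing.isZmodMorphism.Build _ _ (lift n) (lift_morphism n).

Let liftE n d : lift n <<d>> = k d n.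
Proof. by rewrite /lift liftU scale1r. Qed.

Let liftDl n n' x : lift (n + n') x = lift n x + lift n' x.
Proof.
apply: (freeg_additive_eq (f := lift (n + n')) (g := lift n \+ lift n')) => d.
by rewrite /= !liftE raddfD.
Qed.

Let liftDr n x x' : lift n (x + x') = lift n x + lift n x'.
Proof. exact: raddfD. Qed.

Lemma tensor_perm_lift :
  exists f : {additive tensor N (permmod D) -> C},
    forall n d, f (tens n <<d>>) = k d n.
Proof.
pose f : {additive tensor N (permmod D) -> C} := HB.pack (tensor_lift lift)
  (GRing.isZmodMorphism.Build _ _ _ (tensor_lift_morphism liftDl liftDr)).
by exists f; move=> n d; rewrite /= (tensor_liftE liftDl liftDr) liftE.
Qed.
End PermutationTensor.

Section RelativeProjectives.
Variable G : groupType.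
Implicit Types (E : ses G) (M N : gmodType G) (D : gsetType G).

Lemma orbit_representatives D :
  exists (rep : D -> D) (tr : D -> G),
    (forall g d, rep (gact g d) = rep d) /\ (forall d, gact (tr d) (rep d) = d).
Proof.
pose orb (d e : D) := `[< exists g, gact g e = d >].
have orb_refl d : orb d d by apply/asboolP; exists 1%g; rewrite gact1.
(* choose depends only on the extension of its predicate, so it returns the
   same point for all elements of an orbit. *)
pose rep d := choose (orb d) d.
have repP d : exists g, gact g (rep d) = d.
  by exact/asboolP/(chooseP (orb_refl d)).
have [tr trP] := choice repP.
exists rep, tr; split=> // g d; rewrite /rep.
have orb_eq : orb (gact g d) =1 orb d.
  move=> e; apply/asboolP/asboolP => -[h he].
    by exists (g^-1 * h)%g; rewrite gactM he -gactM mulVg gact1.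
  by exists (g * h)%g; rewrite gactM he.
by rewrite (eq_choose orb_eq); apply: choose_id => //; rewrite -orb_eq.
Qed.

(** A section over the stabilizer of the representative of an orbit is
    transported along the orbit by conjugation. The outcome does not depend on
    the element used for the transport, because two such elements differ by
    one of the stabilizer. *)
Lemma D_split_equivariant D E : D_split D E ->
  exists t : D -> {additive ses_quo E -> ses_mid E},
    (forall g d c, t (gact g d) (gact g c) = gact g (t d c)) /\
    (forall d c, ses_proj E (t d c) = c).
Proof.
move=> splitE; have [rep [tr [repJ trP]]] := orbit_representatives D.
have [s sP] : {s : D -> {additive ses_quo E -> ses_mid E} | forall d,
    (forall h c, h \in stab d -> s d (gact h c) = gact h (s d c)) /\
    (forall c, ses_proj E (s d c) = c)}.
  exists (fun d => projT1 (cid (splitE d))) => d.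
  exact: projT2 (cid (splitE d)).
exists (fun d => gact (tr d) \o s (rep d) \o gact (tr d)^-1%g).
split=> [g d c|d c] /=; last first.
  by rewrite ghomJ (sP _).2 -gactM mulgV gact1.
set e := gact g d; pose k := ((tr e)^-1 * g * tr d)%g.
(* k measures the failure of the transports to e and to d to match. *)
have k_stab : k \in stab (rep d).
  rewrite in_stab /k !gactM trP -/e; apply/eqP.
  by rewrite -[RHS]gact1 -(mulVg (tr e)) gactM -(repJ g d) trP.
have -> : gact (tr e)^-1%g (gact g c) = gact k (gact (tr d)^-1%g c).
  by rewrite -!gactM /k -!mulgA mulgV mulg1.
rewrite repJ (sP _).1 // -!gactM /k.
by rewrite !mulgA mulgV mul1g.
Qed.

Lemma mk_ghomE M N (f : M -> N) (f_ghom : is_ghom f) x : mk_ghom f_ghom x = f x.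
Proof. by []. Qed.

(** The complement is the kernel of the retraction. *)
Lemma direct_summandP M X :
  direct_summand M X <-> exists (i : ghom M X) (q : ghom X M), cancel i q.
Proof.
split=> [[K [f [f' fK f'K]]]|[i [q iK]]].
  have f_inj := can_inj fK.
  have i_ghom : is_ghom (fun m => f' (m, 0)).
    split=> [x y|g x]; apply: f_inj.
      by rewrite raddfB /= !f'K; congr (_, _); rewrite /= subrr.
    by rewrite ghomJ !f'K; congr (_, _); rewrite /= raddf0.
  have q_ghom : is_ghom (fun x => (f x).1).
    by split=> [x y|g x]; rewrite ?raddfB ?ghomJ.
  by exists (mk_ghom i_ghom), (mk_ghom q_ghom) => m; rewrite !mk_ghomE f'K.
have rP x : x - i (q x) \in gker q.
  by apply/eqP; rewrite raddfB /= iK subrr.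
pose r x : submodule (gker q) := exist (fun y => y \in gker q) _ (rP x).
have f_ghom : is_ghom (fun x => (q x, r x)).
  split=> [x y|g x]; congr (_, _); rewrite ?raddfB ?ghomJ //; apply: val_inj.
    rewrite /= (raddfB q) (raddfB i) !opprB [LHS]addrACA [RHS]addrACA.
    by rewrite [- y + _]addrC.
  by rewrite /= !ghomJ raddfB.
exists (submodule (gker q)), (mk_ghom f_ghom).
exists (fun u => i u.1 + val u.2) => [x|[m [y yP]]]; rewrite mk_ghomE /=.
  by rewrite addrC subrK.
have /eqP qy := yP; have qm : q (i m + y) = m by rewrite raddfD /= iK qy addr0.
congr (_, _) => //; apply: val_inj.
by rewrite /= qm addrAC subrr add0r.
Qed.

Lemma gact_tens_perm N D g n d :
  gact g (tens n <<d>> : tensor N (permmod D)) = tens (gact g n) <<gact g d>>.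
Proof. by rewrite [LHS]tensor_actE [X in tens _ X]perm_actE. Qed.

Lemma D_projective_lift D E M (phi : ghom M (ses_quo E)) :
  D_projective D M -> D_split D E ->
  exists psi : ghom M (ses_mid E), forall x, ses_proj E (psi x) = phi x.
Proof.
move=> [N /direct_summandP[i [q iK]]] /D_split_equivariant[t [tJ projt]].
(* The lift sends n (x) d to t_d (phi (q (n (x) d))). *)
have [f fE] := tensor_perm_lift (fun d => t d \o phi \o q \o tens_basis N d).
have f_ghom : is_ghom f.
  split=> [|g x]; first exact: raddfB.
  apply: (tensor_perm_eq (f := f \o gact g) (g := gact g \o f)) => n d.
  by rewrite /= gact_tens_perm !fE /= -tJ -!ghomJ gact_tens_perm.
have projf : ses_proj E \o f =1 phi \o q.
  apply: (tensor_perm_eq (f := ses_proj E \o f) (g := phi \o q)) => n d.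
  by rewrite /= fE projt.
exists (ghom_comp (mk_ghom f_ghom) i) => x.
exact: etrans (projf (i x)) (congr1 phi (iK x)).
Qed.
End RelativeProjectives.

Section Augmentation.
Variables (G : groupType) (M : gmodType G) (D : gsetType G).

Lemma exists_augmentation :
  exists f : ghom (tensor M (permmod D)) M, forall m d, f (tens m <<d>>) = m.
Proof.
have [f fE] := tensor_perm_lift (fun _ : D => (idfun : {additive M -> M})).
have f_ghom : is_ghom f.
  split=> [|g x]; first exact: raddfB.
  apply: (tensor_perm_eq (f := f \o gact g) (g := gact g \o f)) => m d.
  by rewrite /= gact_tens_perm !fE.
by exists (mk_ghom f_ghom); exact: fE.
Qed.
End Augmentation.

Section RelativeClasses.
Variable G : groupType.
Implicit Types (E : ses G) (M : gmodType G) (F : groupType -> Prop).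

Lemma F_projective_lift F E M (phi : ghom M (ses_quo E)) :
  F_projective F M -> F_split F E ->
  exists psi : ghom M (ses_mid E), forall x, ses_proj E (psi x) = phi x.
Proof.
move=> [D clD projM] /(F_splitP _ clD) splitE.
apply: D_projective_lift projM _ => d.
by apply: splitE; apply: classifying_stab.
Qed.

(** The augmentation of M tensored with the permutation module of D is split
    relative to F, hence relative to F', hence split over G when M is
    F'-projective. The point of D makes the augmentation surjective. *)
Lemma F_projective_of_split F F' (D : gsetType G) M :
  classifying F D -> D -> (forall E, F_split F E -> F_split F' E) ->
  F_projective F' M -> F_projective F M.
Proof.
move=> clD d0 splitFF' projM; exists D => //; exists M.
have [f fE] := exists_augmentation M D.
have f_surj m : exists x, f x = m by exists (tens m <<d0>>).
have f_exact x : f x = 0 <-> exists k, submod_incl (gker f) k = x.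
  split=> [fx|[k <-]]; last exact/eqP/(valP k).
  have xK : x \in gker f by apply/eqP.
  by exists (exist _ x xK).
pose E := SES (@submod_incl_inj _ _ (gker f)) f_surj f_exact.
have splitE : F_split F' E.
  apply: splitFF'; exists D => // d.
  (* Tensoring with a basis element is equivariant for its stabilizer. *)
  exists (tens_basis M d); split=> [h m /eqP hd|m]; last exact: fE.
  by rewrite /= gact_tens_perm hd.
have id_ghom : is_ghom (idfun : M -> M) by split.
have [s fs] := F_projective_lift (E := E) (mk_ghom id_ghom) projM splitE.
by apply/direct_summandP; exists s, f.
Qed.

(** Guarantees that the classifying G-sets are not empty. *)
Lemma prime_power_trivial : exists H : groupClosed G,
  prime_power_groups (subgroup H).
Proof.
have one1 : 1%g \in pred1 (1%g : G) by rewrite inE.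
have oneM : mulg_closed (pred1 (1%g : G)).
  by move=> x y; rewrite !inE => /eqP-> /eqP->; rewrite mulg1.
have oneV : invg_closed (pred1 (1%g : G)).
  by move=> x; rewrite !inE => /eqP->; rewrite invg1.
pose H : groupClosed G := HB.pack (pred1 (1%g : G) : {pred G})
  (isMulClosed.Build G (pred1 (1%g : G)) oneM)
  (isMul1Closed.Build G (pred1 (1%g : G)) one1)
  (isInvClosed.Build G (pred1 (1%g : G)) oneV).
exists H, 2%N, 0%N; split=> //; rewrite expn0 -card_unit.
apply: (card_bijective (f := fun _ => 1%g : subgroup H)).
exists (fun _ => tt) => [[] //|x]; apply: val_inj.
by have /eqP := valP x.
Qed.

Lemma finite_projective_iff M :
  F_projective finite_groups M <-> F_projective prime_power_groups M.
Proof.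
have [D clD] := exists_classifying G finite_groups_closed.
have [D' clD'] := exists_classifying G prime_power_closed.
have [H ppH] := prime_power_trivial.
have [d _] := (clD H).2 (prime_power_finite ppH).
have [d' _] := (clD' H).2 ppH.
split.
  by apply: F_projective_of_split clD' d' _ => E /finite_split_iff.
by apply: F_projective_of_split clD d _ => E /finite_split_iff.
Qed.

(** An arbitrary map f gives the sequence of its kernel and image, so that maps
    into the image of f can be lifted. *)
Lemma F_projective_lift_along F M (B C : gmodType G) (f : ghom B C)
    (phi : ghom M C) :
  F_projective F M -> F_split F (ker_im_ses f) ->
  (forall x, exists y, f y = phi x) ->
  exists psi : ghom M B, forall x, f (psi x) = phi x.
Proof.
move=> projM splitf phi_im.
have phiP x : phi x \in gim f by apply/asboolP.
pose phi' x : submodule (gim f) := exist (fun y => y \in gim f) _ (phiP x).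
have phi'_ghom : is_ghom phi'.
  by split=> [x y|g x]; apply: val_inj; rewrite /= ?raddfB ?ghomJ.
have [psi psiP] :=
  F_projective_lift (E := ker_im_ses f) (mk_ghom phi'_ghom) projM splitf.
exists psi => x.
exact: (congr1 (fun y : submodule (gim f) => val y) (psiP x)).
Qed.
End RelativeClasses.

(** * Comparison of resolutions *)

Lemma ghom_compE (G : groupType) (A B C : gmodType G) (u : ghom B C)
  (v : ghom A B) x : ghom_comp u v x = u (v x).
Proof. by []. Qed.

Lemma ghom_subE (G : groupType) (A B : gmodType G) (u v : ghom A B) x :
  (u - v : ghom A B) x = u x - v x.
Proof. by []. Qed.

(** Dependent choice along a family of types; the invariant I is what allows one
    more step to be taken. *)
Lemma dependent_sequence (T : nat -> Type) (R : forall n, T n -> T n.+1 -> Prop)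
    (I : forall n, T n -> Prop) (x0 : T 0%N) :
  I 0%N x0 -> (forall n x, I n x -> exists2 y, R n x y & I n.+1 y) ->
  exists u : forall n, T n, u 0%N = x0 /\ forall n, R n (u n) (u n.+1).
Proof.
move=> I0 step.
pose next n (x : {x | I n x}) : {y | R n (sval x) y & I n.+1 y} :=
  cid2 (step n (sval x) (svalP x)).
pose fix v n : {x | I n x} :=
  if n is m.+1
  then exist (I m.+1) (s2val (next m (v m))) (s2valP' (next m (v m)))
  else exist (I 0%N) x0 I0.
by exists (fun n => sval (v n)); split=> // n; exact: s2valP (next n (v n)).
Qed.

Section Comparison.
Variables (G : groupType) (M : gmodType G).

(** The only consequence of projectivity of P and of splitness of Q that the
    comparison argument needs. The two resolutions may be relative to different
    classes. *)
Definition lifts_against F F' (P : resolution F M) (Q : resolution F' M) :=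
  (forall n (phi : ghom (P n) M), exists psi : ghom (P n) (Q 0%N),
     forall x, res_aug Q (psi x) = phi x) /\
  (forall n m (phi : ghom (P n) (Q m)),
     (forall x, exists y, res_d Q m y = phi x) ->
     exists psi : ghom (P n) (Q m.+1), forall x, res_d Q m (psi x) = phi x).

Definition is_chain_map F F' (P : resolution F M) (Q : resolution F' M)
    (f : forall n, ghom (P n) (Q n)) :=
  (forall x, res_aug Q (f 0%N x) = res_aug P x) /\
  (forall n x, res_d Q n (f n.+1 x) = f n (res_d P n x)).

Arguments is_chain_map {F F'} P Q f.

Lemma res_dd F (P : resolution F M) n x : res_d P n (res_d P n.+1 x) = 0.
Proof. by apply/res_exact; exists x. Qed.

Lemma res_aug_d F (P : resolution F M) x : res_aug P (res_d P 0%N x) = 0.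
Proof. by apply/res_exact0; exists x. Qed.

Lemma exists_chain_map F F' (P : resolution F M) (Q : resolution F' M) :
  lifts_against P Q -> exists f, is_chain_map P Q f.
Proof.
move=> [lift0 lift].
have [f0 f0P] := lift0 0%N (res_aug P).
have [|n a aP|f [f_0 f_S]] := dependent_sequence
  (T := fun n => ghom (P n) (Q n)) (x0 := f0)
  (R := fun n a b => forall x, res_d Q n (b x) = a (res_d P n x))
  (I := fun n a => forall x, exists y, res_d Q n y = a (res_d P n x)).
- by move=> x; apply/res_exact0; rewrite f0P res_aug_d.
- have [b bP] := lift n.+1 n (ghom_comp a (res_d P n)) aP.
  by exists b => // x; apply/res_exact; rewrite bP ghom_compE res_dd raddf0.
by exists f; split=> // x; rewrite f_0 f0P.
Qed.

Definition homotopy F F' (P : resolution F M) (Q : resolution F' M)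
    (f g : forall n, ghom (P n) (Q n)) (h : forall n, ghom (P n) (Q n.+1)) :=
  (forall x, f 0%N x - g 0%N x = res_d Q 0%N (h 0%N x)) /\
  (forall n x, f n.+1 x - g n.+1 x =
     res_d Q n.+1 (h n.+1 x) + h n (res_d P n x)).

Arguments homotopy {F F'} P Q f g h.

(** The difference of two chain maps over the identity of M is a chain map that
    is zero on M; its contraction is built degree by degree. *)
Lemma exists_homotopy F F' (P : resolution F M) (Q : resolution F' M) f g :
  lifts_against P Q -> is_chain_map P Q f -> is_chain_map P Q g ->
  exists h, homotopy P Q f g h.
Proof.
move=> [_ lift] [f_aug f_d] [g_aug g_d].
pose e n : ghom (P n) (Q n) := f n - g n.
have eE n x : e n x = f n x - g n x by [].
have e_d n x : res_d Q n (e n.+1 x) = e n (res_d P n x).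
  by rewrite !eE raddfB /= f_d g_d.
have [h0 h0P] : exists h0 : ghom (P 0%N) (Q 1%N),
    forall x, res_d Q 0%N (h0 x) = e 0%N x.
  apply: lift => x; apply/res_exact0.
  by rewrite eE raddfB /= f_aug g_aug subrr.
have [|n a aP|h [h_0 h_S]] := dependent_sequence
  (T := fun n => ghom (P n) (Q n.+1)) (x0 := h0)
  (R := fun n a b => forall x,
     res_d Q n.+1 (b x) = e n.+1 x - a (res_d P n x))
  (I := fun n a => forall x, exists y,
     res_d Q n.+1 y = e n.+1 x - a (res_d P n x)).
- by move=> x; apply/res_exact; rewrite raddfB /= h0P e_d subrr.
- have [b bP] := lift n.+1 n.+1 (e n.+1 - ghom_comp a (res_d P n)) aP.
  exists b => // x; apply/res_exact; rewrite raddfB /= e_d bP ghom_subE.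
  by rewrite ghom_compE res_dd raddf0 subr0 subrr.
exists h; split=> [x|n x]; first by rewrite h_0 h0P.
by rewrite h_S subrK.
Qed.
End Comparison.

Arguments is_chain_map {G M F F'} P Q f.
Arguments homotopy {G M F F'} P Q f g h.

(** * Invariance of relative cohomology *)

Section InducedMaps.
Variables (G : groupType) (M : gmodType G) (F F' : groupType -> Prop).
Variables (P : resolution F M) (Q : resolution F' M).
Variable f : forall n, ghom (P n) (Q n).
Hypothesis f_chain : is_chain_map P Q f.
Variable N : gmodType G.

Definition precomp n (u : ghom (Q n) N) : ghom (P n) N := ghom_comp u (f n).

Fact precomp_morphism n : zmod_morphism (@precomp n).
Proof. by move=> u v; apply: val_inj. Qed.
HB.instance Definition _ n :=
  GRing.isZmodMorphism.Build _ _ (@precomp n) (@precomp_morphism n).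

Fact precomp_comm n (u : ghom (Q n) N) : precomp (hom_d u) = hom_d (precomp u).
Proof.
apply: val_inj; apply/funext => x.
exact: (congr1 (fun y => u y) (f_chain.2 n x)).
Qed.

Definition precomp_map : cochain_map (hom_cochain Q N) (hom_cochain P N) :=
  @CochainMap (hom_cochain Q N) (hom_cochain P N) (fun n => @precomp n)
    precomp_comm.
End InducedMaps.

Section Homotopy.
Variables (G : groupType) (M : gmodType G) (F : groupType -> Prop).
Variable P : resolution F M.

(** For a cocycle z, the term z h d of the homotopy formula is a coboundary, and
    the term z d h vanishes. *)
Lemma homotopy_coboundary f g h (N : gmodType G) n (z : ghom (P n) N) :
  homotopy P P f g h -> hom_d z = 0 ->
  is_coboundary (C := hom_cochain P N) (ghom_comp z (f n) - ghom_comp z (g n)).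
Proof.
move=> [h0 hS] dz.
have zd x : z (res_d P n x) = 0.
  exact: (congr1 (fun u : ghom _ _ => u x) dz).
case: n z dz zd => [|n] z _ zd /=.
  apply: val_inj; apply/funext => x.
  transitivity (z (f 0%N x - g 0%N x)); first exact/esym/(raddfB z).
  by rewrite h0 zd.
exists (ghom_comp z (h n)); apply: val_inj; apply/funext => x.
transitivity (z (f n.+1 x - g n.+1 x)); last exact: (raddfB z).
by rewrite hS raddfD /= zd add0r.
Qed.
End Homotopy.

Lemma qpi_surj (A : zmodType) (I : zmodClosed A) x : exists y, qpi I y = x.
Proof. by exists (generic_quotient.repr x); exact: qpi_repr. Qed.

Section ComparisonIsomorphism.
Variables (G : groupType) (M : gmodType G) (F F' : groupType -> Prop).
Variables (P : resolution F M) (Q : resolution F' M).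
Variables (f : forall n, ghom (P n) (Q n)) (g : forall n, ghom (Q n) (P n)).
Hypotheses (f_chain : is_chain_map P Q f) (g_chain : is_chain_map Q P g).

(** The composite of f and g lifts the identity of M, hence is homotopic to the
    identity of P. *)
Lemma precomp_cohomologyK (N : gmodType G) n :
  lifts_against P P ->
  cancel (@cohomology_map _ _ (precomp_map g_chain N) n)
         (@cohomology_map _ _ (precomp_map f_chain N) n).
Proof.
move=> liftPP x.
have id_ghom k : is_ghom (idfun : P k -> P k) by split.
have [h hP] : exists h, homotopy P P (fun k => ghom_comp (g k) (f k))
    (fun k => mk_ghom (id_ghom k)) h.
  apply: exists_homotopy => //; split=> [y|k y].
    by rewrite ghom_compE g_chain.1 f_chain.1.
  by rewrite !ghom_compE g_chain.2 f_chain.2.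
have [z <-] := qpi_surj x.
rewrite !cohomology_mapE; apply/eqP; rewrite qpi_eq; apply/asboolP.
have zd : hom_d (val z) = 0 by exact/eqP/(valP z).
rewrite (_ : val _ = ghom_comp (val z) (ghom_comp (g n) (f n)) -
                     ghom_comp (val z) (mk_ghom (id_ghom n))).
  exact: (homotopy_coboundary hP zd).
by apply: val_inj.
Qed.

Lemma precomp_cohomology_natural (N N' : gmodType G) (u : ghom N N') n
    (x : rel_cohomology Q n N) :
  @cohomology_map _ _ (precomp_map f_chain N') n (rel_cohomology_map Q u x) =
  rel_cohomology_map P u (@cohomology_map _ _ (precomp_map f_chain N) n x).
Proof.
have [z <-] := qpi_surj x.
rewrite /rel_cohomology_map !cohomology_mapE; congr (qpi _ _).
by apply: val_inj; apply: val_inj.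
Qed.
End ComparisonIsomorphism.

Lemma rel_cohomology_iso (G : groupType) (M : gmodType G)
    (F F' : groupType -> Prop) (P : resolution F M) (Q : resolution F' M) n :
  lifts_against P P -> lifts_against P Q ->
  lifts_against Q P -> lifts_against Q Q ->
  exists phi : forall N : gmodType G,
      {additive rel_cohomology P n N -> rel_cohomology Q n N},
    (forall N, bijective (phi N)) /\
    (forall (N N' : gmodType G) (u : ghom N N') (x : rel_cohomology P n N),
       phi N' (rel_cohomology_map P u x) = rel_cohomology_map Q u (phi N x)).
Proof.
move=> PP /exists_chain_map[f f_chain] /exists_chain_map[g g_chain] QQ.
exists (fun N => @cohomology_map _ _ (precomp_map g_chain N) n); split=> [N|].
  exists (@cohomology_map _ _ (precomp_map f_chain N) n).
    exact: precomp_cohomologyK.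
  exact: precomp_cohomologyK.
by move=> N N' u x; exact: (precomp_cohomology_natural g_chain u x).
Qed.

(** The sequences that make up Q are F'-split, hence F-split, and the terms of P
    are F-projective. *)
Lemma resolution_lifts (G : groupType) (M : gmodType G)
    (F F' : groupType -> Prop) (P : resolution F M) (Q : resolution F' M) :
  (forall E : ses G, F_split F' E -> F_split F E) -> lifts_against P Q.
Proof.
move=> splitF'F; split=> [n phi|n m phi phi_im].
  apply: F_projective_lift_along (res_proj P n) _ _ => [|x].
    exact/splitF'F/res_split0.
  exact: res_surj.
apply: F_projective_lift_along (res_proj P n) _ phi_im.
exact/splitF'F/res_split.
Qed.

Theorem theorem4p1 (G : groupType) :
  (forall E : ses G,
     F_split finite_groups E <-> F_split prime_power_groups E) /\
  (forall M : gmodType G,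
     F_projective finite_groups M <-> F_projective prime_power_groups M) /\
  (forall (P : resolution finite_groups (trivZ G))
          (Q : resolution prime_power_groups (trivZ G)) (n : nat),
     exists phi : forall N : gmodType G,
         {additive rel_cohomology P n N -> rel_cohomology Q n N},
       (forall N, bijective (phi N)) /\
       (forall (N N' : gmodType G) (u : ghom N N') (x : rel_cohomology P n N),
          phi N' (rel_cohomology_map P u x) =
          rel_cohomology_map Q u (phi N x))).
Proof.
split; first exact: finite_split_iff.
split; first exact: finite_projective_iff.
by move=> P Q n; apply: rel_cohomology_iso; apply: resolution_lifts => E;
  rewrite ?finite_split_iff.
Qed.
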